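(* Let $n\ge 1$ and $d\ge 1$ be integers, let $f$ be a real homogeneous polynomial of degree $d$ in the variables $x_1,\dots,x_n$, and let $r\ge d$ be an integer. Then $$f_{\Delta(n,r)}-f_{\min}^{(r-d)}\le \frac{(r+d-1)^{\underline{d}}-r^d}{r^{\underline{d}}}\binom{2d-1}{d}d^d\left(\overline{f}-\underline{f}\right).$$
   Context: For an integer $d\ge 0$, $t^{\underline{d}}:=t(t-1)(t-2)\cdots(t-d+1)$ denotes the falling factorial. The standard simplex is $\Delta_n:=\{x\in\mathbb{R}^n: x_i\ge 0 \text{ for all } i,\ \sum_{i=1}^n x_i=1\}$. Put $\underline{f}:=\min_{x\in\Delta_n}f(x)$ and $\overline{f}:=\max_{x\in\Delta_n}f(x)$. For an integer $r\ge 1$, the regular grid is $\Delta(n,r):=\{x\in\Delta_n: rx\in\mathbb{N}^n\}$, where $\mathbb{N}^n$ is the set of nonnegative integer vectors, and $f_{\Delta(n,r)}:=\min_{x\in\Delta(n,r)}f(x)$. For a real homogeneous polynomial $f$ of degree $d$ in $x_1,\dots,x_n$ and an integer $r\ge d$, the quantity $f_{\min}^{(r-d)}$ is the maximum of all real $\lambda$ such that the polynomial $\left(\sum_{i=1}^n x_i\right)^{r-d}\left(f-\lambda\left(\sum_{i=1}^n x_i\right)^d\right)$ has only nonnegative coefficients. *)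

(* Defs.v *)
(* MathComp / MathComp-Analysis, with multinomials for multivariate polynomials.
   The notations of [mpoly] are left out: they clash with those of analysis. *)
From HB Require Import structures.
From mathcomp Require Import all_boot all_order all_algebra.
From mathcomp Require Import all_classical all_reals all_analysis.
From mathcomp Require Import -(notations) mpoly.
Import Order.TTheory GRing.Theory Num.Theory.

Set Implicit Arguments.
Unset Strict Implicit.
Unset Printing Implicit Defensive.

Local Open Scope classical_set_scope.
Local Open Scope ring_scope.

(* Attained extrema: the default value 0 is returned when [A] has no least
   (resp. greatest) element, which does not happen for the sets used below. *)
Definition set_min (R : realType) (A : set R) : R := xget 0 (A `&` lbound A).

Definition set_max (R : realType) (A : set R) : R := xget 0 (A `&` ubound A).

Definition simplex (R : realType) (n : nat) : set 'rV[R]_n :=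
  [set x | (forall i, 0 <= x 0 i) /\ \sum_i x 0 i = 1].

Definition grid (R : realType) (n r : nat) : set 'rV[R]_n :=
  [set x | simplex x /\ forall i, r%:R * x 0 i \is a Num.nat].

Definition peval (R : realType) (n : nat) (f : mpoly n R)
    (x : 'rV[R]_n) : R := meval (fun i => x 0 i) f.

(* The zero polynomial is homogeneous of every degree. *)
Definition homogeneous (R : realType) (n d : nat) (f : mpoly n R) : Prop :=
  f \is ishomog1 d (@mdeg n).

Definition sumX (R : realType) (n : nat) : mpoly n R :=
  \sum_(i < n) mpolyX R (mnm1 i).

Definition nonneg_coeffs (R : realType) (n : nat) (p : mpoly n R) : Prop :=
  forall m, 0 <= mcoeff m p.

Definition simplex_min (R : realType) (n : nat) (f : mpoly n R) : R :=
  set_min (peval f @` @simplex R n).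

Definition simplex_max (R : realType) (n : nat) (f : mpoly n R) : R :=
  set_max (peval f @` @simplex R n).

Definition grid_min (R : realType) (n r : nat) (f : mpoly n R) : R :=
  set_min (peval f @` @grid R n r).

(* $f_{\min}^{(k)}$, for [f] homogeneous of degree [d]. *)
Definition polya_bound (R : realType) (n d k : nat) (f : mpoly n R) : R :=
  set_max [set lam : R |
    nonneg_coeffs (sumX R n ^+ k * (f - lam *: sumX R n ^+ d))].

(* Main.v *)
(* Write s for the sum of the variables.  The iterated finite difference
   sum_(e <= b) (-1)^|b - e| C(b, e) g(e) of a form g of degree d = |b| at the
   origin equals b! g_b, since any other monomial of degree d has an exponent
   smaller than the order of the difference in some variable.  As g(e) is
   |e|^d times a value of g on the simplex, a form bounded by D there has
   |g_b| <= D d^d (2^d - 1) / d! * (s^d)_b.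
   On the other hand, f_min^(r - d) = W(f), where
   W(p) := (s^(r - d) p)_a / (s^r)_a for a suitable exponent a of degree r.
   Comparing falling factorials with powers gives theta W(p) <= p(a / r), with
   theta := r(r - 1)...(r - d + 1) / r^d, for forms p of degree d with
   nonnegative coefficients.  Applying this to C s^d - g, and W >= 0 to
   C s^d + g, where g := f - mid s^d is centred at the middle of the range of f
   and |g_b| <= C (s^d)_b, yields f(a / r) - W(f) <= 2 C (1 - theta).  The
   stated constant comes from 2^d - 1 <= d! C(2d - 1, d) and from
   2 r^d <= r(r - 1)...(r - d + 1) + r(r + 1)...(r + d - 1). *)
Require Import Defs.
From mathcomp Require Import all_boot all_order all_algebra.
From mathcomp Require Import all_classical all_reals all_analysis.
From mathcomp Require Import -(notations) mpoly.
From mathcomp Require Import ring lra zify.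
Import Order.TTheory GRing.Theory Num.Theory.
Import numFieldNormedType.Exports.

Local Open Scope classical_set_scope.
Local Open Scope ring_scope.

(** * Coefficients of powers of the sum of the variables *)

Lemma mcoeffMX_cond (R : realType) (n : nat) (p : mpoly n R) (m k : multinom n) :
  mcoeff k (p * mpolyX R m) =
    if lem m k then mcoeff (mnm_sub k m) p else 0.
Proof.
case: ifPn => [le_mk|nle_mk].
  by rewrite -[in LHS](submK le_mk) addmC mcoeffMX.
apply: memN_msupp_eq0; apply: contra nle_mk.
rewrite (perm_mem (msuppMX p m)) => /mapP[m' _ ->].
exact: lem_addr.
Qed.

(** The multinomial theorem, cleared of denominators and covering all exponents. In the induction,
    splitting off a last factor [x_i] contributes a factor [m i], and these add up to [mdeg m]. *)
Lemma mcoeff_sumX_exp (R : realType) (n k : nat) (m : multinom n) :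
  mcoeff m (sumX R n ^+ k) * (\prod_i (m i)`!)%:R = (k`! * (mdeg m == k))%:R.
Proof.
elim: k m => [|k IHk] m.
  rewrite expr0 mcoeff1 mdeg_eq0 mul1n; case: eqP => [->|]; last by rewrite mul0r.
  by rewrite big1 ?mulr1// => i _; rewrite mnm0E.
rewrite exprSr {2}/sumX mulr_sumr raddf_sum /= mulr_suml.
have IH i : mcoeff m (sumX R n ^+ k * mpolyX R (mnm1 i)) *
    (\prod_i (m i)`!)%:R = (k`! * (mdeg m == k.+1) * m i)%:R.
  rewrite mcoeffMX_cond lep1mP; have [mi0|mi0] := eqVneq (m i) 0%N.
    by rewrite /= mi0 muln0 mul0r.
  have le1 : lem (mnm1 i) m by rewrite lep1mP.
  have dm : mdeg m = (mdeg (mnm_sub m (mnm1 i))).+1.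
    by rewrite -{1}(submK le1) mdegD mdeg1 addn1.
  have -> : (\prod_j (m j)`! = m i * \prod_j (mnm_sub m (mnm1 i) j)`!)%N.
    rewrite (bigD1 i)//= [in RHS](bigD1 i)//= mulnA; congr (_ * _)%N.
      by rewrite mnmBE mnm1E eqxx subn1; case: (m i) mi0.
    by apply: eq_bigr => j /negPf ji; rewrite mnmBE mnm1E eq_sym ji subn0.
  by rewrite /= natrM mulrCA IHk mulrC -natrM dm eqSS.
rewrite (eq_bigr _ (fun i _ => IH i)).
rewrite -natr_sum -big_distrr/= -mdegE mulnAC factS (mulnC k.+1).
by have [->|_] := eqVneq (mdeg m) k.+1; rewrite ?muln0.
Qed.

Lemma mcoeff_sumX_exp_gt0 (R : realType) (n : nat) (m : multinom n) :
  0 < mcoeff m (sumX R n ^+ mdeg m).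
Proof.
have P_gt0 : 0 < (\prod_i (m i)`!)%:R :> R.
  by rewrite ltr0n prodn_gt0// => i; rewrite fact_gt0.
by rewrite -(pmulr_lgt0 _ P_gt0) mcoeff_sumX_exp eqxx muln1 ltr0n fact_gt0.
Qed.

Lemma sumX_homog (R : realType) (n k : nat) :
  homogeneous k (sumX R n ^+ k).
Proof.
have h1 : sumX R n \is ishomog1 1 (@mdeg n).
  by apply: rpred_sum => i _; rewrite dhomogX; apply/eqP; exact: mdeg1.
by have := dhomogMn k h1; rewrite mul1n.
Qed.

Lemma peval_sumX (R : realType) (n : nat) (x : 'rV[R]_n) :
  peval (sumX R n) x = \sum_i x 0 i.
Proof.
by rewrite /peval /sumX raddf_sum; apply: eq_bigr => i _; rewrite /= mevalXU.
Qed.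

(** Since [q] has nonnegative coefficients, it suffices to treat a monomial [x^m]. If [m <= a], then
    after multiplication by the product of the [(a i)!] the left side is [(d + k)!] times the
    product of the falling factorials [(a i) ^_ (m i)], and the right side is the same with powers
    [(a i) ^ (m i)]. Otherwise the left side is 0. *)
Lemma ffact_mcoeff_le (R : realType) (n d k : nat) (q : mpoly n R)
    (a : multinom n) :
    homogeneous d q -> nonneg_coeffs q -> mdeg a = (d + k)%N ->
  ((d + k) ^_ d)%:R * mcoeff a (sumX R n ^+ k * q) <=
  mcoeff a (sumX R n ^+ (d + k)) * meval (fun i => (a i)%:R) q.
Proof.
move=> hq q0 ha.
have -> : mcoeff a (sumX R n ^+ k * q) =
    \sum_(m <- msupp q) mcoeff m q * mcoeff a (sumX R n ^+ k * mpolyX R m).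
  rewrite [in LHS](mpolyE q) mulr_sumr raddf_sum.
  by apply: eq_bigr => m _; rewrite -scalerAr /= mcoeffZ.
rewrite mevalE !mulr_sumr !big_seq; apply: ler_sum => m mq.
rewrite mulrCA [leRHS]mulrCA ler_wpM2l ?q0//.
have P_gt0 : 0 < (\prod_i (a i)`!)%:R :> R.
  by rewrite ltr0n prodn_gt0// => i; rewrite fact_gt0.
rewrite mcoeffMX_cond; case: ifPn => [lema|_]; last first.
  rewrite mulr0 mulr_ge0//; first by rewrite -ha ltW// mcoeff_sumX_exp_gt0.
  by apply: prodr_ge0 => i _; rewrite exprn_ge0// ler0n.
have dB : mdeg (mnm_sub a m) = k.
  apply/eqP; rewrite -(eqn_add2r (mdeg m)) -mdegD submK// ha addnC.
  by rewrite (dhomog_mf hq mq).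
rewrite -(ler_pM2r P_gt0) [leRHS]mulrAC mcoeff_sumX_exp ha eqxx muln1.
have -> : (\prod_i (a i)`! =
    (\prod_i (mnm_sub a m i)`!) * \prod_i (a i) ^_ (m i))%N.
  rewrite -big_split/=; apply: eq_bigr => i _; rewrite mnmBE mulnC.
  by rewrite ffact_fact//; exact: (mnm_lepP lema).
rewrite natrM -mulrA (mulrA (mcoeff _ _)) mcoeff_sumX_exp dB eqxx muln1.
rewrite mulrA -natrM -{2}(addKn d k) ffact_fact ?leq_addr//.
rewrite ler_wpM2l ?ler0n// natr_prod; apply: ler_prod => i _.
rewrite ler0n -natrX ler_nat; elim: (m i) => [|j IHj]; first by rewrite ffactn0.
by rewrite ffactnSr expnSr leq_mul// leq_subr.
Qed.

(** * Finite differences and the size of coefficients *)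

(** This is the [b]-th finite difference of [k ^ c] at 0, with [0 ^ 0 = 1]. The induction on [b]
    absorbs one factor [k] into the binomial coefficient, shifts the index and expands
    [(1 + k) ^ c]; only the top power can survive. *)
Lemma alternating_binomial_sum (R : comNzRingType) (b c : nat) :
    (c <= b)%N ->
  \sum_(k < b.+1) (-1) ^+ (b + k) * 'C(b, k)%:R * k%:R ^+ c =
    (b`! * (c == b))%:R :> R.
Proof.
elim: b c => [|b IHb] [|c] cb.
- by rewrite big_ord_recl big_ord0 addr0 !expr0 !mul1r.
- by [].
- have := exprDn (-1 : R) 1 b.+1; rewrite addNr expr0n/= => S0.
  rewrite muln0 [RHS]S0; apply: eq_bigr => k _.
  rewrite expr0 expr1n !mulr1 mulr_natr -signr_odd -[in RHS]signr_odd.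
  by rewrite oddD oddB// -ltnS.
rewrite big_ord_recl/= expr0n/= mulr0 add0r.
transitivity (b.+1%:R * \sum_(i < c.+1) 'C(c, i)%:R *
    \sum_(k < b.+1) (-1) ^+ (b + k) * 'C(b, k)%:R * k%:R ^+ i :> R).
  rewrite mulr_sumr; under [RHS]eq_bigr => i _ do rewrite !mulr_sumr.
  rewrite exchange_big/=; apply: eq_bigr => k _.
  rewrite /bump/= add1n addSn addnS !exprS mulrA mulN1r mulN1r opprK.
  rewrite -[k.+1]add1n [in X in _ * X = _]natrD exprDn !mulr_sumr.
  apply: eq_bigr => i _; rewrite expr1n mul1r -[_ *+ _]mulr_natl add1n.
  have /(congr1 (fun x => x%:R : R)) := mul_bin_diag b.+1 k.
  rewrite !natrM/= => E.
  transitivity ((k.+1%:R * 'C(b.+1, k.+1)%:R) *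
    ((-1) ^+ (b + k) * k%:R ^+ i * 'C(c, i)%:R) : R).
    by rewrite -['C(b.+1, k.+1)%:R]mulr1; ring.
  by rewrite -E; ring.
rewrite big_ord_recr/= big1 ?add0r => [|i _]; last first.
  have ib : (i < b)%N by exact: leq_trans (ltn_ord i) _.
  by rewrite IHb 1?ltnW// (ltn_eqF ib) muln0 mulr0.
by rewrite IHb// binn mul1r -natrM mulnA -factS eqSS.
Qed.

(** The sum runs over the whole box of points with coordinates at most [d], which makes it a product
    of one-variable sums on each monomial; the binomial coefficients vanish unless [e <= b]. *)
Lemma coef_finite_difference (R : realType) (n d : nat) (g : mpoly n R)
    (b : multinom n) :
    homogeneous d g -> mdeg b = d ->
  mcoeff b g * (\prod_i (b i)`!)%:R =
  \sum_(e : {ffun 'I_n -> 'I_d.+1})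
    (\prod_i ((-1) ^+ (b i + e i) * 'C(b i, e i)%:R)) *
    meval (fun i => (e i)%:R) g.
Proof.
move=> hg hb.
have b_le i : (b i < d.+1)%N by rewrite ltnS -hb mdegE (bigD1 i)//= leq_addr.
have U (c : multinom n) : mdeg c = d ->
    \sum_(e : {ffun 'I_n -> 'I_d.+1})
      (\prod_i ((-1) ^+ (b i + e i) * 'C(b i, e i)%:R)) *
      (\prod_i (e i)%:R ^+ c i) =
    (c == b)%:R * (\prod_i (b i)`!)%:R :> R.
  move=> hc.
  transitivity (\prod_i \sum_(k < d.+1)
      (-1) ^+ (b i + k) * 'C(b i, k)%:R * k%:R ^+ c i : R).
    rewrite bigA_distr_bigA; apply: eq_bigr => e _.
    by rewrite -big_split.
  have widen i : \sum_(k < d.+1)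
      (-1) ^+ (b i + k) * 'C(b i, k)%:R * k%:R ^+ c i =
      \sum_(k < (b i).+1)
      (-1) ^+ (b i + k) * 'C(b i, k)%:R * k%:R ^+ c i :> R.
    rewrite [RHS](big_ord_widen d.+1 (fun k => (-1) ^+ (b i + k) * 'C(b i, k)%:R * k%:R ^+ c i))//.
    rewrite [LHS](bigID (fun k : 'I_d.+1 => (k < (b i).+1)%N))/=.
    rewrite [X in _ + X]big1 ?addr0// => k; rewrite -leqNgt => bk.
    by rewrite bin_small// mulr0 mul0r.
  have [cb|cb] := eqVneq c b.
    rewrite mul1r natr_prod; apply: eq_bigr => i _.
    by rewrite widen cb alternating_binomial_sum// eqxx muln1.
  (* Two distinct exponents of equal degree cannot satisfy [b <= c]; the one-variable difference at
     such an [i] is 0 and kills the product. *)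
  have [i cbi] : exists i, (c i < b i)%N.
    apply/existsP; apply: contraNT cb => /existsPn H.
    have bc : lem b c by apply/mnm_lepP => i; rewrite leqNgt H.
    have : mdeg (mnm_sub c b) = 0%N.
      by apply/eqP; rewrite -(eqn_add2r (mdeg b)) -mdegD submK// hb hc.
    move/eqP; rewrite mdeg_eq0 => /eqP E.
    by rewrite -(submK bc) E add0m.
  rewrite mul0r (bigD1 i)//= widen alternating_binomial_sum 1?ltnW//.
  by rewrite (ltn_eqF cbi) muln0 mul0r.
transitivity (\sum_(e : {ffun 'I_n -> 'I_d.+1}) \sum_(m <- msupp g)
    (\prod_i ((-1) ^+ (b i + e i) * 'C(b i, e i)%:R)) *
    (mcoeff m g * \prod_i (e i)%:R ^+ m i)); last first.
  by apply: eq_bigr => e _; rewrite mevalE mulr_sumr.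
rewrite exchange_big/=.
transitivity (\sum_(m <- msupp g)
    mcoeff m g * ((m == b)%:R * (\prod_i (b i)`!)%:R)); last first.
  rewrite big_seq [RHS]big_seq; apply: eq_bigr => m mg.
  rewrite -U; last exact: (dhomog_mf hg mg).
  by rewrite mulr_sumr; apply: eq_bigr => e _; rewrite mulrCA.
have [bg|bg] := boolP (b \in msupp g).
  rewrite (bigD1_seq b)//= ?msupp_uniq// eqxx mul1r [X in _ + X]big1 ?addr0// => m mb.
  by rewrite (negPf mb) mul0r mulr0.
rewrite (memN_msupp_eq0 bg) mul0r big_seq [RHS]big1// => m mg.
have [mb|_] := eqVneq m b; last by rewrite mul0r mulr0.
by rewrite -mb mg in bg.
Qed.

Lemma meval_scale (R : realType) (n d : nat) (f : mpoly n R) (c : R)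
    (x : 'I_n -> R) :
  homogeneous d f -> meval (fun i => c * x i) f = c ^+ d * meval x f.
Proof.
move=> hf; rewrite !mevalE mulr_sumr !big_seq; apply: eq_bigr => m mf.
rewrite -(dhomog_mf hf mf) mulrCA; congr (_ * _).
under eq_bigr => i _ do rewrite exprMn.
by rewrite big_split/= prodrXr -mdegE.
Qed.

Lemma expn2_le_ffact (m j : nat) : (j < m)%N -> (2 ^ j <= m ^_ j)%N.
Proof.
elim: j => [|j IHj] jm; first by rewrite ffactn0.
by rewrite ffactnSr expnSr leq_mul ?IHj ?ltn_subRL ?addn1// ltnW.
Qed.

(** The right side is the falling factorial of [2 * d - 1] with [d] factors, all at least 2 once
    [d >= 2]. For [d = 1] both sides are 1. *)
Lemma expn2B1_le (d : nat) : (0 < d)%N -> (2 ^ d - 1 <= 'C(2 * d - 1, d) * d`!)%N.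
Proof.
case: d => [//|[//|d]] _.
rewrite bin_ffact (leq_trans (leq_subr _ _))// expn2_le_ffact//.
by rewrite mul2n -addnn addSn subn1 /= -[X in (X < _)%N]add0n ltn_add2r.
Qed.

Lemma mcoeff_le_simplex_bound (R : realType) (n d : nat) (g : mpoly n R) (D : R)
    (b : multinom n) :
    (0 < d)%N -> homogeneous d g -> 0 <= D ->
    (forall x, simplex x -> `|peval g x| <= D) ->
  `|mcoeff b g| <=
  D * (d%:R ^+ d * 'C(2 * d - 1, d)%:R) * mcoeff b (sumX R n ^+ d).
Proof.
move=> d_gt0 hg D0 gD.
have [hb|nb] := eqVneq (mdeg b) d; last first.
  rewrite (dhomog_nemf_coeff hg nb) normr0.
  by rewrite (dhomog_nemf_coeff (@sumX_homog R n d) nb) mulr0.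
have P_gt0 : 0 < (\prod_i (b i)`!)%:R :> R.
  by rewrite ltr0n prodn_gt0// => i; rewrite fact_gt0.
rewrite -(ler_pM2r P_gt0) -[leRHS]mulrA mcoeff_sumX_exp hb eqxx muln1.
rewrite -[X in _ * X <= _](gtr0_norm P_gt0) -normrM (coef_finite_difference _ _ _ _ _ hg hb).
(* These are the absolute weights of the sample points. They add up to [2 ^ d], and the origin [z],
   where [g] vanishes because [d > 0], takes one unit; the resulting [2 ^ d - 1] is sharp enough
   even for [d = 1]. *)
pose w (e : {ffun 'I_n -> 'I_d.+1}) := (\prod_i 'C(b i, e i))%N.
pose z : {ffun 'I_n -> 'I_d.+1} := [ffun=> ord0].
have wz : w z = 1%N by rewrite /w big1// => i _; rewrite ffunE bin0.
have sum_w : (\sum_e w e = 2 ^ d)%N.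
  transitivity (\prod_i \sum_(k < d.+1) 'C(b i, k))%N.
    by rewrite bigA_distr_bigA.
  rewrite -[in RHS]hb mdegE expn_sum; apply: eq_bigr => i _.
  have bd : (b i <= d)%N by rewrite -hb mdegE (bigD1 i)//= leq_addr.
  have := expnDn 1 1 (b i); rewrite addnn => ->.
  rewrite [RHS](big_ord_widen d.+1 (fun k => 'C(b i, k) * (1 ^ (b i - k) * 1 ^ k))%N)//.
  rewrite [LHS](bigID (fun k : 'I_d.+1 => (k < (b i).+1)%N))/=.
  rewrite [X in (_ + X)%N]big1 ?addn0 => [|k].
    by apply: eq_bigr => k _; rewrite !exp1n !muln1.
  by rewrite -leqNgt => bk; rewrite bin_small.
have bound (e : {ffun 'I_n -> 'I_d.+1}) : `|(\prod_i ((-1) ^+ (b i + e i) * 'C(b i, e i)%:R)) *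
    meval (fun i => (e i)%:R) g| <= (w e * (e != z))%:R * (d%:R ^+ d * D).
  have -> : `|(\prod_i ((-1) ^+ (b i + e i) * 'C(b i, e i)%:R)) *
      meval (fun i => (e i)%:R) g| = (w e)%:R * `|meval (fun i => (e i)%:R) g|.
    rewrite normrM normr_prod natr_prod; congr (_ * _).
    by apply: eq_bigr => i _; rewrite normrM normrX normrN1 expr1n mul1r normr_nat.
  pose s := (\sum_i e i)%N.
  have [ez|ez] := eqVneq e z.
    rewrite muln0 mul0r.
    (* The origin is written as a multiple by 0, so that homogeneity yields the factor
       [0 ^ d = 0]. *)
    have -> : meval (fun i => (e i)%:R) g = meval (fun i => 0 * 0) g :> R.
      by apply: meval_eq => i; rewrite ez ffunE mul0r.
    by rewrite (meval_scale _ _ _ _ 0 _ hg) expr0n eqn0Ngt d_gt0 mul0r normr0 mulr0.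
  have s_gt0 : (0 < s)%N.
    rewrite lt0n; apply: contra ez; rewrite sum_nat_eq0 => /forallP s0.
    by apply/eqP/ffunP => i; rewrite ffunE; apply/val_inj/eqP; apply: s0.
  rewrite muln1; have [/existsP[i bi]|/existsPn be] := boolP [exists i, (b i < e i)%N].
    by rewrite /w (bigD1 i)//= bin_small// mul0n !mul0r.
  rewrite ler_wpM2l ?ler0n//.
  have sd : (s <= d)%N.
    by rewrite -hb mdegE; apply: leq_sum => i _; rewrite leqNgt be.
  (* Dividing [e] by its coordinate sum [s] lands in the simplex and costs a factor
     [s ^ d <= d ^ d]. *)
  pose x : 'rV[R]_n := \row_i ((e i)%:R / s%:R).
  have sx : simplex x.
    split=> [i|]; first by rewrite mxE divr_ge0 ?ler0n.
    under eq_bigr => i _ do rewrite mxE.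
    by rewrite -mulr_suml -natr_sum divff// pnatr_eq0 -lt0n.
  have -> : meval (fun i => (e i)%:R) g = s%:R ^+ d * peval g x.
    rewrite /peval -(meval_scale _ _ _ _ _ _ hg); apply: meval_eq => i.
    by rewrite mxE mulrCA divff ?mulr1// pnatr_eq0 -lt0n.
  rewrite normrM normrX normr_nat ler_pM ?exprn_ge0 ?ler0n ?gD//.
  by rewrite lerXn2r ?nnegrE ?ler0n ?ler_nat.
apply: (le_trans (ler_norm_sum _ _ _)).
apply: (le_trans (ler_sum _ (fun e _ => bound e))).
rewrite -mulr_suml -natr_sum.
have -> : (\sum_e w e * (e != z) = 2 ^ d - 1)%N.
  rewrite -sum_w [in RHS](bigD1 z)//= wz addKn (bigD1 z)//= eqxx muln0 add0n.
  by apply: eq_bigr => e ->; rewrite muln1.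
have -> : D * (d%:R ^+ d * 'C(2 * d - 1, d)%:R) * d`!%:R =
    ('C(2 * d - 1, d) * d`!)%:R * (d%:R ^+ d * D) :> R by rewrite natrM; ring.
by rewrite ler_wpM2r ?mulr_ge0 ?exprn_ge0 ?ler0n// ler_nat expn2B1_le.
Qed.

(** * Attained extrema on the simplex *)

Lemma set_min_eq (R : realType) (A : set R) (m : R) :
  A m -> lbound A m -> set_min A = m.
Proof.
move=> Am lb; apply: xget_unique => // y [Ay lby].
by apply/eqP; rewrite eq_le lby//= lb.
Qed.

Lemma set_max_eq (R : realType) (A : set R) (m : R) :
  A m -> ubound A m -> set_max A = m.
Proof.
move=> Am ub; apply: xget_unique => // y [Ay uby].
by apply/eqP; rewrite eq_le uby//= ub.
Qed.

Lemma peval_continuous (R : realType) (n : nat) (f : mpoly n R) :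
  continuous (peval f : 'rV[R]_n -> R).
Proof.
have cX (m : multinom n) :
    continuous (fun x : 'rV[R]_n => \prod_i x 0 i ^+ m i : R).
  apply: (@continuous_big R _ *%R 1 xpredT (@mul_continuous R)) => i _.
  move=> x; apply: (@continuous_comp _ _ _ (fun y : 'rV[R]_n => y 0 i : R)
    (fun y : R => y ^+ m i)); first exact: coord_continuous.
  exact: exprn_continuous.
have -> : peval f = fun x : 'rV[R]_n =>
    \sum_(m <- msupp f) mcoeff m f * \prod_i x 0 i ^+ m i.
  by apply/funext => x; rewrite /peval mevalE.
apply: (@continuous_big R _ +%R 0 xpredT (@add_continuous R)) => m _.
by move=> x; apply: continuousM; [exact: cst_continuous|exact: cX].
Qed.

(** The simplex is a closed subset of the unit cube. *)
Lemma simplex_compact (R : realType) (n : nat) : compact (@simplex R n).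
Proof.
have closed_sum1 : closed [set x : 'rV[R]_n | \sum_i x 0 i = 1].
  have -> : [set x : 'rV[R]_n | \sum_i x 0 i = 1] =
      peval (sumX R n) @^-1` [set y | y = 1].
    by apply/seteqP; split => x /=; rewrite peval_sumX.
  exact: (iffLR (continuous_closedP _) (@peval_continuous R n _) _ (@closed_eq R 1)).
have compact_cube : compact
    [set x : 'rV[R]_n | forall i, `[(0 : R), 1]%classic (x ord0 i)].
  by apply: (@rV_compact R n (fun=> `[0, 1]%classic)) => _; exact: segment_compact.
apply: (subclosed_compact _ compact_cube).
  rewrite (_ : @simplex R n = [set x : 'rV[R]_n | \sum_i x 0 i = 1] `&`
    \bigcap_(i in [set: 'I_n]) [set x : 'rV[R]_n | 0 <= x 0 i]).
    apply: closedI => //; apply: closed_bigI => i _.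
    exact: (iffLR (continuous_closedP _) (@coord_continuous R 1 n 0 i) _ (@closed_ge R 0)).
  apply/seteqP; split => x /= [].
    by move=> x0 x1; split => // i _; exact: x0.
  by move=> x1 x0; split => // i; exact: x0.
move=> x [x0 x1] i /=; rewrite in_itv/= x0/= -x1 (bigD1 i)//= lerDl.
by apply: sumr_ge0 => j _; exact: x0.
Qed.

(** Compactness supplies a minimiser, so [set_min] returns the true minimum and not its default. *)
Lemma simplex_min_le (R : realType) (n : nat) (f : mpoly n R) (x : 'rV[R]_n) :
  simplex x -> simplex_min f <= peval f x.
Proof.
move=> sx; have s0 : (@simplex R n) !=set0 by exists x.
have [|c sc cmin] := EVT_min_rV s0 (@simplex_compact R n) (f := peval f).
  exact/continuous_subspaceT/peval_continuous.
rewrite /simplex_min (@set_min_eq _ _ (peval f c)).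
- by apply: cmin; rewrite inE.
- by exists c => //; rewrite inE in sc.
- by move=> _ [y sy <-]; apply: cmin; rewrite inE.
Qed.

Lemma simplex_max_ge (R : realType) (n : nat) (f : mpoly n R) (x : 'rV[R]_n) :
  simplex x -> peval f x <= simplex_max f.
Proof.
move=> sx; have s0 : (@simplex R n) !=set0 by exists x.
have [|c sc cmax] := EVT_max_rV s0 (@simplex_compact R n) (f := peval f).
  exact/continuous_subspaceT/peval_continuous.
rewrite /simplex_max (@set_max_eq _ _ (peval f c)).
- by apply: cmax; rewrite inE.
- by exists c => //; rewrite inE in sc.
- by move=> _ [y sy <-]; apply: cmax; rewrite inE.
Qed.

(** * The grid, parametrised by exponents of degree [r] *)

Definition grid_point (R : realType) (n r : nat) (a : multinom n) : 'rV[R]_n :=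
  \row_i ((a i)%:R / r%:R).

Lemma grid_pointP (R : realType) (n r : nat) (x : 'rV[R]_n) :
    (0 < r)%N ->
  grid r x <-> exists2 a : multinom n, mdeg a = r & x = grid_point R n r a.
Proof.
move=> r_gt0; have r0 : r%:R != 0 :> R by rewrite pnatr_eq0 -lt0n.
split=> [[[x0 x1] xn]|[a ar ->]].
  have rx i : r%:R * x 0 i = (Num.trunc (r%:R * x 0 i))%:R.
    by rewrite truncnK.
  exists (Multinom [tuple Num.trunc (r%:R * x 0 i) | i < n]).
    apply/eqP; rewrite -(eqr_nat R) mdegE natr_sum; apply/eqP.
    transitivity (\sum_i r%:R * x 0 i); last by rewrite -mulr_sumr x1 mulr1.
    by apply: eq_bigr => i _; rewrite [RHS]rx multinomE tnth_mktuple.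
  apply/rowP => i; rewrite mxE multinomE tnth_mktuple -rx.
  by rewrite mulrAC divff// mul1r.
split; last by move=> i; rewrite mxE mulrCA divff// mulr1.
split=> [i|]; first by rewrite mxE divr_ge0 ?ler0n.
under eq_bigr => i _ do rewrite mxE.
by rewrite -mulr_suml -natr_sum -mdegE ar divff.
Qed.

(** Exponents of degree [r] sit in the finite type of exponents of degree less than [r + 1]; the
    exponent of the [r]-th power of the first variable, available as [n > 0], shows that there is
    one. *)
Lemma exists_min_multinom (R : realType) (n r : nat) (F : multinom n -> R) :
    (0 < n)%N ->
  exists2 a, mdeg a = r & forall b, mdeg b = r -> F a <= F b.
Proof.
case: n F => [//|n] F _.
have m0r : (mdeg (mnm_muln (mnm1 (@ord0 n)) r) < r.+1)%N.
  by rewrite mdegMn mdeg1 mul1n.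
pose m0 := BMultinom m0r.
have P0 : mdeg m0 == r by rewrite /= mdegMn mdeg1 mul1n.
pose G (m : bmultinom n.+1 r.+1) := F m.
case: (@Order.TotalTheory.arg_minP _ _ _ m0 (fun m => mdeg m == r) G P0) => a /eqP ar amin.
exists a => // b br.
have br1 : (mdeg b < r.+1)%N by rewrite br.
by apply: (amin (BMultinom br1)); rewrite /= br.
Qed.

Lemma grid_min_le (R : realType) (n r : nat) (f : mpoly n R) (x : 'rV[R]_n) :
  (0 < n)%N -> (0 < r)%N -> grid r x -> grid_min r f <= peval f x.
Proof.
move=> n_gt0 r_gt0 gx.
have [a ar amin] := exists_min_multinom _ _ r (fun a => peval f (grid_point R n r a)) n_gt0.
have lb : lbound (peval f @` @grid R n r) (peval f (grid_point R n r a)).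
  by move=> _ [y /(grid_pointP _ _ _ _ r_gt0)[b br ->] <-]; exact: amin.
rewrite /grid_min (@set_min_eq _ _ (peval f (grid_point R n r a)))//.
  by apply: lb; exists x.
by exists (grid_point R n r a) => //; apply/grid_pointP => //; exists a.
Qed.

(** * Falling and rising factorials against powers *)

Lemma ffact_le_expn (m j : nat) : (m ^_ j <= m ^ j)%N.
Proof.
elim: j => [|j IHj]; first by rewrite ffactn0.
by rewrite ffactnSr expnSr leq_mul// leq_subr.
Qed.

(** Let [A], [C], [B] be the falling factorial, the rising factorial and the power with [d] factors.
    The induction step needs [2 r B <= (r - d) A + (r + d) C]. The right side is
    [r (A + C) + d (C - A)], where [A + C >= 2 B] by induction, and [C >= A] follows from this and
    [A <= B]. *)
Lemma expn_le_mean_ffact (r d : nat) :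
  (d <= r)%N -> (2 * r ^ d <= r ^_ d + (r + d - 1) ^_ d)%N.
Proof.
elim: d => [|d IHd] dr; first by rewrite !ffactn0.
have := IHd (ltnW dr); have := ffact_le_expn r d.
have -> : (r + d.+1 - 1 = r + d)%N by lia.
have -> : ((r + d) ^_ d.+1 = (r + d) * (r + d - 1) ^_ d)%N.
  by rewrite ffactnS subn1.
rewrite ffactnSr expnSr; move: (r ^_ d) ((r + d - 1) ^_ d) (r ^ d)%N => A C B.
move=> AB BAC; have -> : (r = r - d + d)%N by rewrite subnK// ltnW.
move: (r - d)%N => e; rewrite addnK; nia.
Qed.

(** * The coefficient bound and its comparison with a grid value *)

Lemma homogeneousD (R : realType) (n d : nat) (p q : mpoly n R) :
  homogeneous d p -> homogeneous d q -> homogeneous d (p + q).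
Proof. exact: dhomogD. Qed.

(** Each coefficient is affine in [lam], so its nonnegativity at an exponent of degree [d + k] says
    that [lam] is at most a ratio of coefficients; exponents of other degrees give 0. The largest
    admissible [lam] is thus the least ratio, attained at some [a]. *)
Lemma polya_bound_attained (R : realType) (n d k : nat) (f : mpoly n R) :
    (0 < n)%N -> homogeneous d f ->
  exists2 a : multinom n, mdeg a = (d + k)%N &
    polya_bound d k f =
      mcoeff a (sumX R n ^+ k * f) / mcoeff a (sumX R n ^+ (d + k)).
Proof.
move=> n_gt0 hf.
have [a ar amin] := exists_min_multinom R n (d + k) (fun a =>
  mcoeff a (sumX R n ^+ k * f) / mcoeff a (sumX R n ^+ (d + k))) n_gt0.
have s_gt0 (b : multinom n) : mdeg b = (d + k)%N ->
    0 < mcoeff b (sumX R n ^+ (d + k)).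
  by move=> <-; exact: mcoeff_sumX_exp_gt0.
have coefE b lam : mcoeff b (sumX R n ^+ k * (f - lam *: sumX R n ^+ d)) =
    mcoeff b (sumX R n ^+ k * f) - lam * mcoeff b (sumX R n ^+ (d + k)).
  by rewrite mulrBr -scalerAr -exprD addnC mcoeffB mcoeffZ.
exists a => //; apply: set_max_eq => [b|lam /(_ a)]; last first.
  by rewrite coefE subr_ge0 -ler_pdivlMr ?s_gt0.
rewrite coefE subr_ge0; have [br|br] := eqVneq (mdeg b) (d + k)%N.
  by rewrite -ler_pdivlMr ?s_gt0// amin.
have hsf : homogeneous (k + d) (sumX R n ^+ k * f).
  exact: (dhomogM (sumX_homog R n k) hf).
rewrite (dhomog_nemf_coeff (sumX_homog R n (d + k)) br) mulr0.
by rewrite (dhomog_nemf_coeff hsf)// addnC.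
Qed.

Lemma peval_grid_point (R : realType) (n d r : nat) (f : mpoly n R)
    (a : multinom n) :
  homogeneous d f ->
  peval f (grid_point R n r a) = meval (fun i => (a i)%:R) f / r%:R ^+ d.
Proof.
move=> hf; rewrite mulrC -exprVn -(meval_scale _ _ _ _ _ _ hf).
by apply: meval_eq => i; rewrite mxE mulrC.
Qed.

Lemma peval_sub_polya_coef_le (R : realType) (n d k : nat) (g : mpoly n R)
    (C : R) (a : multinom n) :
    (0 < d)%N -> homogeneous d g -> mdeg a = (d + k)%N ->
    (forall b, `|mcoeff b g| <= C * mcoeff b (sumX R n ^+ d)) ->
  peval g (grid_point R n (d + k) a) -
    mcoeff a (sumX R n ^+ k * g) / mcoeff a (sumX R n ^+ (d + k)) <=
  2 * C * (1 - ((d + k) ^_ d)%:R / (d + k)%:R ^+ d).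
Proof.
move=> d_gt0 hg ar gC; set x := grid_point _ _ _ _; set theta := _ / _.
have r_gt0 : 0 < (d + k)%:R :> R by rewrite ltr0n addn_gt0 d_gt0.
pose s := sumX R n.
have sr_gt0 : 0 < mcoeff a (s ^+ (d + k)) by rewrite -ar mcoeff_sumX_exp_gt0.
pose W p := mcoeff a (s ^+ k * p) / mcoeff a (s ^+ (d + k)).
have hs : homogeneous d (s ^+ d) := sumX_homog R n d.
have theta_le1 : theta <= 1.
  by rewrite ler_pdivrMr ?exprn_gt0// mul1r -natrX ler_nat ffact_le_expn.
have W_ge0 q : nonneg_coeffs q -> 0 <= W q.
  move=> q0; rewrite divr_ge0 ?(ltW sr_gt0)// mcoeffM.
  apply: sumr_ge0 => c _; rewrite mulr_ge0 ?q0//.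
  have [<-|ne] := eqVneq (mdeg c.1) k; first exact/ltW/mcoeff_sumX_exp_gt0.
  by rewrite (dhomog_nemf_coeff (sumX_homog R n k) ne).
have W_le q : homogeneous d q -> nonneg_coeffs q -> theta * W q <= peval q x.
  move=> hq q0; rewrite (peval_grid_point _ _ _ _ _ _ hq).
  have -> : theta * W q = ((d + k) ^_ d)%:R * mcoeff a (s ^+ k * q) /
      mcoeff a (s ^+ (d + k)) / (d + k)%:R ^+ d by rewrite /theta /W; ring.
  rewrite ler_pM2r ?invr_gt0 ?exprn_gt0// ler_pdivrMr// [leRHS]mulrC.
  exact: ffact_mcoeff_le.
have WD p q : W (p + q) = W p + W q by rewrite /W mulrDr mcoeffD mulrDl.
have WZ c p : W (c *: p) = c * W p by rewrite /W -scalerAr mcoeffZ mulrA.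
have Ws : W (s ^+ d) = 1 by rewrite /W -exprD addnC divff// gt_eqF.
have xs : peval (s ^+ d) x = 1.
  rewrite /peval rmorphXn/= -/(peval s x) peval_sumX.
  suff [[_ ->] _] : grid (d + k) x by rewrite expr1n.
  by apply/grid_pointP; [rewrite addn_gt0 d_gt0|exists a].
have hC c : homogeneous d (C *: s ^+ d + c *: g).
  by apply: homogeneousD; exact: dhomogZ.
have nonneg c : `|c| = 1 -> nonneg_coeffs (C *: s ^+ d + c *: g).
  move=> c1 b; rewrite mcoeffD !mcoeffZ -lerBlDr sub0r.
  by rewrite (le_trans _ (gC b))// -[leRHS]mul1r -c1 -normrM -normrN ler_norm.
(* With [w = W g] and [v] the value of [g] at [x], the two facts read [theta (C - w) <= C - v] and
   [C + w >= 0]. Hence [v - w <= (1 - theta) (C - w) <= 2 C (1 - theta)]. *)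
have := W_le _ (hC (-1)) (nonneg _ (normrN1 _)).
have := W_ge0 _ (nonneg 1 (normr1 _)).
rewrite /peval mevalD !mevalZ -/(peval _ _) -/(peval _ _) xs !WD !WZ Ws -/(W g).
move: (W g) (peval g x) => w v; nra.
Qed.

(** * Centring the form and assembling the constants *)

Theorem theorem7 (R : realType) (n d r : nat) (f : mpoly n R)
    (hn : (1 <= n)%N) (hd : (1 <= d)%N) (hf : homogeneous d f)
    (hr : (d <= r)%N) :
  grid_min r f - polya_bound d (r - d)%N f <=
    (((r + d - 1) ^_ d)%:R - r%:R ^+ d) / (r ^_ d)%:R *
    'C(2 * d - 1, d)%:R * d%:R ^+ d * (simplex_max f - simplex_min f).
Proof.
have [k rE] : exists k, r = (d + k)%N by exists (r - d)%N; rewrite subnKC.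
have r_gt0 : (0 < r)%N by exact: leq_trans hr.
have -> : (r - d = k)%N by rewrite rE addKn.
have [a ar ->] := polya_bound_attained _ _ _ k _ hn hf.
(* The exponent that realises the coefficient bound also provides the grid point at which [f] is
   compared with it. *)
pose x := grid_point R n r a.
have gx : grid r x by apply/grid_pointP => //; exists a => //; rewrite ar rE.
have gmin := grid_min_le _ _ _ f _ hn r_gt0 gx.
set M := simplex_max f; set m := simplex_min f.
have mM : m <= M.
  exact: le_trans (simplex_min_le _ _ _ _ gx.1) (simplex_max_ge _ _ _ _ gx.1).
(* Centring makes the absolute value on the simplex at most [(M - m) / 2]; this half later cancels
   the factor 2 in front of [C]. *)
pose g := f + (- ((M + m) / 2)) *: sumX R n ^+ d.
have hg : homogeneous d g.
  by apply: homogeneousD => //; apply: dhomogZ; exact: sumX_homog.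
have gE y : simplex y -> peval g y = peval f y - (M + m) / 2.
  move=> [_ y1]; rewrite /peval mevalD mevalZ rmorphXn/= -/(peval f y) -/(peval (sumX R n) y).
  by rewrite peval_sumX y1 expr1n mulr1.
have gD y : simplex y -> `|peval g y| <= (M - m) / 2.
  move=> sy; rewrite gE// ler_norml.
  have := simplex_min_le _ _ f _ sy; have := simplex_max_ge _ _ f _ sy.
  by rewrite -/M -/m => *; apply/andP; split; lra.
have D_ge0 : 0 <= (M - m) / 2 by lra.
have := peval_sub_polya_coef_le _ _ _ k _ _ _ hd hg ar
  (fun b => mcoeff_le_simplex_bound _ _ _ _ _ b hd hg D_ge0 gD).
(* The shift by a multiple of [sumX R n ^+ d] changes the grid value and the coefficient ratio by
   the same constant, so their difference is the one for [f]. *)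
rewrite -rE (gE _ gx.1) /g mulrDr -scalerAr -exprD addnC -rE mcoeffD mcoeffZ.
have s_gt0 : 0 < mcoeff a (sumX R n ^+ r).
  by rewrite rE -ar mcoeff_sumX_exp_gt0.
rewrite [(_ + _ * mcoeff _ _) / _]mulrDl mulfK ?gt_eqF// => key.
set K := d%:R ^+ d * 'C(2 * d - 1, d)%:R : R.
have K_ge0 : 0 <= K by rewrite mulr_ge0 ?exprn_ge0 ?ler0n.
have A_gt0 : 0 < (r ^_ d)%:R :> R by rewrite ltr0n ffact_gt0.
have AB : (r ^_ d)%:R <= r%:R ^+ d :> R by rewrite -natrX ler_nat ffact_le_expn.
have BC : r%:R ^+ d - (r ^_ d)%:R <= ((r + d - 1) ^_ d)%:R - r%:R ^+ d :> R.
  have := expn_le_mean_ffact r d hr.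
  by rewrite -(ler_nat R) natrD natrM natrX => *; lra.
(* Over the common denominator [r ^ d], the numerator grows by [BC] and the denominator shrinks to
   the falling factorial by [AB]. *)
have theta_le : 1 - (r ^_ d)%:R / r%:R ^+ d <=
    (((r + d - 1) ^_ d)%:R - r%:R ^+ d) / (r ^_ d)%:R :> R.
  have B_gt0 := lt_le_trans A_gt0 AB.
  have -> : 1 - (r ^_ d)%:R / r%:R ^+ d =
      (r%:R ^+ d - (r ^_ d)%:R) / r%:R ^+ d :> R.
    by rewrite mulrBl divff// gt_eqF.
  by rewrite ler_pM ?invr_ge0 ?subr_ge0 ?(ltW B_gt0)// lef_pV2.
apply: (@le_trans _ _ (K * (M - m) * (1 - (r ^_ d)%:R / r%:R ^+ d))).
  move: key; rewrite -/K.
  have -> : 2 * ((M - m) / 2 * K) = K * (M - m) by field.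
  move: gmin; rewrite -/x; lra.
have -> : (((r + d - 1) ^_ d)%:R - r%:R ^+ d) / (r ^_ d)%:R *
    'C(2 * d - 1, d)%:R * d%:R ^+ d * (M - m) =
  K * (M - m) * ((((r + d - 1) ^_ d)%:R - r%:R ^+ d) / (r ^_ d)%:R) :> R.
  by rewrite /K; ring.
by rewrite ler_wpM2l// mulr_ge0// subr_ge0.
Qed.
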